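(* Let $d, q\geq 2$ be natural numbers. Then there exists a subset $U$ of the vertices of the Hamming graph $H(d,q)$ of size $|U|=q^{d-1}$ such that the VC-dimension of $(U,n(U))$ is $1$.
   Context: The Hamming graph $H(d,q)$ has vertex set $\mathbb Z_q^d$, with two vertices adjacent if and only if they differ in exactly one coordinate. For a vertex $x$, $n(x)$ denotes its neighborhood, the set of vertices adjacent to $x$ (so $x\notin n(x)$), and for a set $U$ of vertices $n(U)=\{n(u):u\in U\}$. A set $W\subseteq U$ is shattered by $n(U)$ if for every $S\subseteq W$ there is $u\in U$ with $n(u)\cap W=S$. The VC-dimension of $(U,n(U))$ is the size of the largest $W\subseteq U$ that is shattered by $n(U)$. *)

(* Defs.v *)
From mathcomp Require Import all_boot all_order all_algebra.

Set Implicit Arguments.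
Unset Strict Implicit.
Unset Printing Implicit Defensive.

(* 'Z_q is the ring of integers mod q only for 1 < q. *)
Definition hamming_vertex (d q : nat) : finType := {ffun 'I_d -> 'Z_q}.

Definition hamming_adj (d q : nat) : rel (hamming_vertex d q) :=
  fun x y => #|[set i | x i != y i]| == 1.

Definition neighborhood (T : finType) (e : rel T) (x : T) : {set T} :=
  [set y | e x y].

Definition neighborhoods (T : finType) (e : rel T) (U : {set T}) :
  {set {set T}} := [set neighborhood e u | u in U].

Definition shattered (T : finType) (F : {set {set T}}) (W : {set T}) : bool :=
  [forall S : {set T}, (S \subset W) ==> [exists A in F, A :&: W == S]].

(* The members of F need not be subsets of U. If F is nonempty then set0 is
   shattered, so the maximum is attained; for F = set0 the value is 0. *)
Definition VC_dim (T : finType) (U : {set T}) (F : {set {set T}}) : nat :=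
  \max_(W : {set T} | (W \subset U) && shattered F W) #|W|.

(* Main.v *)
Require Import Defs.
From mathcomp Require Import all_boot all_order all_algebra.

(** The zero-sum vertices form an independent set of size [q ^ (d - 1)].
    Exchanging its element [0] for the unit vector [e_0] gives a set inducing a
    star centred at [e_0] together with isolated vertices. The only possible
    common neighbour of two vertices is then the centre, so two vertices with a
    common neighbour are leaves; as leaves have no other neighbour, no
    neighbourhood contains exactly one of them. *)

Lemma star_VC_dim (T : finType) (e : rel T) (U : {set T}) (c v : T) :
    irreflexive e ->
    {in U &, forall x y, e x y -> (x == c) || (y == c)} ->
    c \in U -> v \in U -> e c v ->
  VC_dim U (neighborhoods e U) = 1.
Proof.
move=> irr star Uc Uv ecv; apply/eqP; rewrite eqn_leq; apply/andP; split.
  apply/bigmax_leqP => W /andP[/subsetP sWU /forallP shW].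
  rewrite leqNgt; apply/negP => /card_gt1P[a [b [Wa Wb neq_ab]]].
  (* Shattering, read pointwise: each [S] inside [W] is cut out by the adjacencies of some [u] in
     [U]. *)
  have trace (S : {set T}) : S \subset W ->
      exists2 u, u \in U & {in W, forall x, e u x = (x \in S)}.
    move=> sSW; have /existsP[A /andP[/imsetP[u Uu ->] /eqP AS]] :=
      implyP (shW S) sSW.
    by exists u => // x Wx; rewrite -AS !inE Wx andbT.
  have [u Uu eu] := trace W (subxx W).
  have sa : [set a] \subset W by rewrite sub1set.
  have [w Uw ew] := trace [set a] sa.
  have eua : e u a by rewrite eu.
  have eub : e u b by rewrite eu.
  have ewa : e w a by rewrite ew ?set11.
  have uc : u = c.
    (* If [u] were not [c], the edges from [u] to [a] and to [b] would force [a = c = b]. *)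
    apply/eqP; have /orP[//|/eqP ac] := star u a Uu (sWU a Wa) eua.
    have /orP[//|/eqP bc] := star u b Uu (sWU b Wb) eub.
    by rewrite ac bc eqxx in neq_ab.
  have wc : w = c.
    (* Otherwise [a = c = u], and [e u a] would be a loop. *)
    apply/eqP; have /orP[//|/eqP ac] := star w a Uw (sWU a Wa) ewa.
    by rewrite ac uc irr in eua.
  by have := ew b Wb; rewrite wc -uc eub inE eq_sym (negbTE neq_ab).
(* Lower bound: [[set v]] is shattered, as the neighbourhood of [c] contains [v] and that of [v]
   itself does not. *)
rewrite -(cards1 v).
apply: (@leq_bigmax_cond _ _ (fun W : {set T} => #|W|)).
rewrite sub1set Uv; apply/forallP => S; apply/implyP; rewrite subset1.
case/orP => /eqP ->; apply/existsP.
  exists (neighborhood e c); rewrite imset_f //=.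
  by apply/eqP/setP => x; rewrite !inE; case: eqP => [->|]; rewrite ?ecv ?andbF.
exists (neighborhood e v); rewrite imset_f //=.
by apply/eqP/setP => x; rewrite !inE; case: eqP => [->|]; rewrite ?irr ?andbF.
Qed.

Import GRing.Theory.
Local Open Scope ring_scope.

Lemma hamming_adj_irr (d q : nat) : irreflexive (@hamming_adj d q).
Proof.
move=> x; rewrite /hamming_adj.
rewrite (_ : [set i | _] = set0) ?cards0 //.
by apply/setP => i; rewrite !inE eqxx.
Qed.

(** All terms but one agree and cancel. Hence the zero-sum vertices are independent. *)
Lemma hamming_adj_sum (d q : nat) (x y : hamming_vertex d q) :
  hamming_adj x y -> \sum_i x i != \sum_i y i.
Proof.
case/cards1P => i /setP xy; rewrite (bigD1 i) //= [X in _ != X](bigD1 i) //=.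
rewrite (eq_bigr y) => [|j ji]; last first.
  by apply/eqP; have := xy j; rewrite !inE (negbTE ji) => /negbFE.
by rewrite (inj_eq (addIr _)); have := xy i; rewrite !inE eqxx.
Qed.

(** The last [n] coordinates are free and determine the one at [ord0] as minus their sum; [f] is
    this parametrization. *)
Lemma card_zero_sum (n q : nat) : (1 < q)%N ->
  #|[set x : hamming_vertex n.+1 q | \sum_i x i == 0]| = (q ^ n)%N.
Proof.
move=> q_gt1.
pose f (y : {ffun 'I_n -> 'Z_q}) : hamming_vertex n.+1 q :=
  [ffun i => if unlift ord0 i is Some j then y j else - \sum_j y j].
have fl y j : f y (lift ord0 j) = y j by rewrite ffunE liftK.
have f0 y : f y ord0 = - \sum_j y j by rewrite ffunE unlift_none.
have f_inj : injective f.
  by move=> y z /ffunP yz; apply/ffunP => j; rewrite -!fl yz.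
have -> : [set x : hamming_vertex n.+1 q | \sum_i x i == 0] = f @: setT.
  apply/setP => x; rewrite inE big_ord_recl addr_eq0; apply/eqP/imsetP.
    move=> x0; exists [ffun j => x (lift ord0 j)] => //; apply/ffunP => i.
    case: (unliftP ord0 i) => [j|] ->; first by rewrite fl ffunE.
    by rewrite f0 x0; congr (- _); apply: eq_bigr => j _; rewrite ffunE.
  case=> y _ ->; rewrite f0; congr (- _).
  by apply: eq_bigr => j _; rewrite fl.
(* [Zp_cast] uses [1 < q]: only then does ['Z_q] have [q] elements. *)
by rewrite card_imset // cardsT card_ffun !card_ord Zp_cast.
Qed.

Local Close Scope ring_scope.

Theorem proposition1p6 (d q : nat) (hd : 2 <= d) (hq : 2 <= q) :
  exists U : {set hamming_vertex d q},
    #|U| = q ^ (d - 1) /\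
    VC_dim U (neighborhoods (@hamming_adj d q) U) = 1.
Proof.
case: d hd => [|[|n]] // _.
pose I := [set x : hamming_vertex n.+2 q | \sum_i x i == 0]%R.
pose o : hamming_vertex n.+2 q := [ffun=> 0%R].
pose i1 : 'I_n.+2 := lift ord0 ord0.
pose c : hamming_vertex n.+2 q := [ffun i => (i == ord0)%:R]%R.
(* The leaf [e_0 - e_1] has sum zero and differs from [c] only at [i1], a coordinate that exists
   because [2 <= d]. *)
pose v : hamming_vertex n.+2 q := [ffun i => (i == ord0)%:R - (i == i1)%:R]%R.
have sum_delta (k : 'I_n.+2) : (\sum_i (i == k)%:R = 1 :> 'Z_q)%R.
  by rewrite (bigD1 k) //= eqxx big1 ?addr0 // => i /negbTE->.
have Io : o \in I by rewrite inE big1 // => i _; rewrite ffunE.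
have Iv : v \in I.
  rewrite inE; under eq_bigr do rewrite ffunE.
  by rewrite sumrB !sum_delta subrr.
have Ic : c \notin I.
  by rewrite inE; under eq_bigr do rewrite ffunE; rewrite sum_delta oner_eq0.
have vo : v != o.
  by apply/eqP => /ffunP/(_ ord0); rewrite !ffunE subr0 => /eqP; rewrite oner_eq0.
have cv : hamming_adj c v.
  apply/cards1P; exists i1; apply/setP => i; rewrite !inE !ffunE.
  rewrite eq_sym -subr_eq0 addrAC subrr add0r oppr_eq0.
  by case: (i == i1); rewrite ?oner_eq0 ?eqxx.
(* The swap preserves the size since [o] lies in [I] and [c] does not; [v] survives it by [vo]. *)
exists (c |: I :\ o); split.
  by rewrite cardsU1 in_setD1 (negbTE Ic) andbF subn1 -(card_zero_sum _ _ hq) (cardsD1 o I) Io.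
apply: (@star_VC_dim _ _ _ c v) => //; first exact: hamming_adj_irr.
(* An edge avoiding [c] would join two zero-sum vertices. *)
- move=> x y /setU1P[->|/setD1P[_]]; first by rewrite eqxx.
  rewrite inE => /eqP x0 /setU1P[->|/setD1P[_]]; first by rewrite eqxx orbT.
  by rewrite inE => /eqP y0 /hamming_adj_sum; rewrite x0 y0 eqxx.
- exact: setU11.
by rewrite in_setU1 in_setD1 vo Iv orbT.
Qed.
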